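(* Let $R$ be an associative ring with identity $1$ and a non-trivial idempotent $e$, put $e_1=e$, $e_2=1-e$, $R_{ij}=e_iRe_j$ for $i,j\in\{1,2\}$, and assume that for all $i,j,k\in\{1,2\}$ and every $a_{ij}\in R_{ij}$: if $a_{ij}x_{jk}=0$ for all $x_{jk}\in R_{jk}$, then $a_{ij}=0$. Let $\varphi:R\to R$ be a multiplicative automorphism of $R$ and let $D:R\to R$ be a multiplicative skew derivation with associated multiplicative automorphism $\varphi$, i.e. a map satisfying $D(ab)=D(a)b+\varphi(a)D(b)$ for all $a,b\in R$. Then $D$ is additive. Moreover, $D$ is a skew derivation on $R$.
   Context: Rings are associative and not assumed commutative. A non-trivial idempotent is an element $e$ with $e^2=e$, $e\neq 0$, $e\neq 1$. A map $f:R\to R$ is additive if $f(a+b)=f(a)+f(b)$ for all $a,b\in R$. A multiplicative automorphism of $R$ is a bijective map $\varphi:R\to R$ with $\varphi(ab)=\varphi(a)\varphi(b)$ for all $a,b\in R$ (additivity not assumed); an automorphism is an additive multiplicative automorphism. A skew derivation (or $\varphi$-derivation) is an additive map $D:R\to R$ with $D(ab)=D(a)b+\varphi(a)D(b)$ for all $a,b\in R$, where $\varphi$ is an automorphism of $R$. *)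

(* Defs.v *)
From HB Require Import structures.
From mathcomp Require Import all_boot all_algebra.
Set Implicit Arguments.
Unset Strict Implicit.
Unset Printing Implicit Defensive.
Import GRing.Theory.
Local Open Scope ring_scope.

Definition nontrivial_idempotent (R : pzRingType) (e : R) : Prop :=
  [/\ e * e = e, e <> 0 & e <> 1].

(* Indices are shifted by one: [peirce_idem e 0] is e_1 = e and
   [peirce_idem e 1] is e_2 = 1 - e. *)
Definition peirce_idem (R : pzRingType) (e : R) (i : 'I_2) : R :=
  if i == ord0 then e else 1 - e.

Definition peirce (R : pzRingType) (e : R) (i j : 'I_2) (a : R) : Prop :=
  exists x : R, a = peirce_idem e i * x * peirce_idem e j.

Definition peirce_right_faithful (R : pzRingType) (e : R) : Prop :=
  forall (i j k : 'I_2) (a : R), peirce e i j a ->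
    (forall x : R, peirce e j k x -> a * x = 0) -> a = 0.

(* Preservation of 0 and of opposites follows, since R is an additive group. *)
Definition additive_map (R : pzRingType) (f : R -> R) : Prop :=
  {morph f : a b / a + b}.

(* [f 1 = 1] is not required: it follows from surjectivity. *)
Definition multiplicative_automorphism (R : pzRingType) (f : R -> R) : Prop :=
  bijective f /\ {morph f : a b / a * b}.

Definition ring_automorphism (R : pzRingType) (f : R -> R) : Prop :=
  additive_map f /\ multiplicative_automorphism f.

Definition skew_leibniz (R : pzRingType) (phi D : R -> R) : Prop :=
  forall a b : R, D (a * b) = D a * b + phi a * D b.

Definition multiplicative_skew_derivation (R : pzRingType)
    (phi D : R -> R) : Prop :=
  multiplicative_automorphism phi /\ skew_leibniz phi D.

(* The twisting map must itself be additive here. *)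
Definition skew_derivation (R : pzRingType) (phi D : R -> R) : Prop :=
  [/\ ring_automorphism phi, additive_map D & skew_leibniz phi D].

(* Main.v *)
(** A failure of additivity of [phi] or [D] is measured by a
    quantity [delta a b] which is homogeneous on the right and, up to a twist
    [psi], on the left: [phi^-1 (phi a + phi b) - (a + b)] with [psi = id], and
    [D (a + b) - (D a + D b)] with [psi = phi]. Homogeneity makes [delta a b]
    vanish when [a] and [b] lie in different rows of the Peirce decomposition.
    For [a], [b] in the same off-diagonal corner [R_ij], the identities
    [a = (e_i + b) a] and [b = (e_i + b) e_j] reduce [delta a b] to
    [delta a e_j], which is the previous case. For [a], [b] in [R_ii], multiply
    by [R_ij] with [j != i] and use faithfulness. *)
Require Import Defs.
From HB Require Import structures.
From mathcomp Require Import all_boot all_algebra.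
Set Implicit Arguments.
Unset Strict Implicit.
Unset Printing Implicit Defensive.
Import GRing.Theory.
Local Open Scope ring_scope.

Section Peirce.
Variables (R : pzRingType) (e : R).
Hypothesis ee : e * e = e.
Local Notation p := (peirce_idem e).

Lemma peirce_idem_sum : p ord0 + p ord_max = 1.
Proof. by rewrite /peirce_idem /= addrC subrK. Qed.

Lemma peirce_idemM (i j : 'I_2) : p i * p j = if i == j then p i else 0.
Proof.
rewrite /peirce_idem; case: i j => [[|[|//]] hi] [[|[|//]] hj];
by rewrite -!val_eqE /= ?mulrBr ?mulrBl ?mulr1 ?mul1r ?ee ?subrr ?subr0.
Qed.

Lemma ord2_neq (i : 'I_2) : exists k : 'I_2, i != k.
Proof. by case: i => [[|[|//]] hi]; [exists ord_max | exists ord0]. Qed.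

Section Defect.
Variables (psi : R -> R) (delta : R -> R -> R).
Hypothesis psi_sum : psi (p ord0) + psi (p ord_max) = 1.
Hypothesis delta0r : forall a, delta a 0 = 0.
Hypothesis delta0l : forall b, delta 0 b = 0.
Hypothesis deltaMr : forall a b x, delta a b * x = delta (a * x) (b * x).
Hypothesis deltaMl : forall a b x, psi x * delta a b = delta (x * a) (x * b).

Lemma eq0_rows (d : R) : (forall i, psi (p i) * d = 0) -> d = 0.
Proof. by move=> h; rewrite -[d]mul1r -psi_sum mulrDl !h addr0. Qed.

Lemma eq0_peirce_rows (d : R) : (forall i, p i * d = 0) -> d = 0.
Proof. by move=> h; rewrite -[d]mul1r -peirce_idem_sum mulrDl !h addr0. Qed.

Lemma eq0_peirce_columns (d : R) : (forall i, d * p i = 0) -> d = 0.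
Proof. by move=> h; rewrite -[d]mulr1 -peirce_idem_sum mulrDr !h addr0. Qed.

(** Left multiplication by [psi (p l)] puts [p l] in front of both arguments; as [i != j], it kills
    at least one of them. *)
Lemma defect_rows (i j : 'I_2) (a b : R) :
  i != j -> delta (p i * a) (p j * b) = 0.
Proof.
move=> nij; apply: eq0_rows => l; rewrite deltaMl !mulrA !peirce_idemM.
case: (eqVneq l i) => [->|_]; first by rewrite (negPf nij) mul0r delta0r.
by rewrite mul0r delta0l.
Qed.

Lemma defect_offdiag (i j : 'I_2) (a b : R) :
  i != j -> delta (p i * a * p j) (p i * b * p j) = 0.
Proof.
move=> nij; set u := p i + p i * b * p j.
have ua : p i * a * p j = u * (p i * a * p j).
  rewrite mulrDl !mulrA -(mulrA _ (p j) (p i)) !peirce_idemM eqxx.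
  by rewrite eq_sym (negPf nij) mulr0 !mul0r addr0.
have uj : p i * b * p j = u * p j.
  rewrite mulrDl -mulrA !peirce_idemM (negPf nij) add0r.
  by rewrite -!mulrA peirce_idemM eqxx.
(* With [psi u] pulled out, the arguments left lie in rows [i] and [j]. *)
rewrite ua uj -deltaMl -[X in delta _ X]mulr1 -(mulrA (p i)).
by rewrite defect_rows ?mulr0.
Qed.

Hypothesis hR : peirce_right_faithful e.

Lemma defect_diag (i : 'I_2) (a b : R) :
  delta (p i * a * p i) (p i * b * p i) = 0.
Proof.
have [k nik] := ord2_neq i; set d := delta _ _.
have di : d = d * p i by rewrite /d deltaMr -!(mulrA _ (p i)) peirce_idemM eqxx.
(* The twist puts [d] in [psi (p i) * R * p i], which need not be a Peirce corner. Cutting by [p l]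
   itself gives an element of [R_li], to which faithfulness applies. *)
apply: eq0_peirce_rows => l.
apply: (hR (i := l) (j := i) (k := k)); first by exists d; rewrite -mulrA -di.
move=> x [y ->].
have Ex z : p i * z * p i * (p i * y * p k) = p i * (z * p i * (p i * y)) * p k.
  by rewrite !mulrA.
by rewrite -mulrA deltaMr !Ex defect_offdiag ?mulr0.
Qed.

(** Cutting by [psi (p i)] on the left and [p j] on the right moves both arguments into [R_ij]. *)
Lemma defect_eq0 (a b : R) : delta a b = 0.
Proof.
apply: eq0_peirce_columns => j; apply: eq0_rows => i.
rewrite deltaMr deltaMl !mulrA.
by case: (eqVneq i j) => [->|nij]; [exact: defect_diag | exact: defect_offdiag].
Qed.

End Defect.

Hypothesis hR : peirce_right_faithful e.

Lemma multiplicative_automorphism_additive (phi : R -> R) :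
  multiplicative_automorphism phi -> additive_map phi.
Proof.
move=> [[g phiK gK] phiM] a b.
have gM x y : g (x * y) = g x * g y by rewrite -{1}[x]gK -{1}[y]gK -phiM phiK.
have phi0 : phi 0 = 0.
  by rewrite -[RHS](mul0r (phi 0)) -[X in X * _]gK -phiM mulr0.
(* Pulling back by [g] removes the twist. With twist [phi], [psi_sum] would be an instance of the
   additivity being proved. *)
pose delta x y := g (phi x + phi y) - (x + y).
suff /eqP : delta a b = 0 by rewrite subr_eq0 => /eqP <-; rewrite gK.
apply: (@defect_eq0 id); rewrite /delta ?peirce_idem_sum //.
- by move=> x; rewrite phi0 !addr0 phiK subrr.
- by move=> x; rewrite phi0 !add0r phiK subrr.
- by move=> x y z; rewrite mulrBl !phiM -!mulrDl gM phiK.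
- by move=> x y z; rewrite mulrBr !phiM -!mulrDr gM phiK.
Qed.

Lemma multiplicative_skew_derivation_additive (phi D : R -> R) :
  ring_automorphism phi -> skew_leibniz phi D -> additive_map D.
Proof.
move=> [phiD [[g phiK gK] phiM]] DM a b.
have phi0 : phi 0 = 0 by apply: (addrI (phi 0)); rewrite -phiD !addr0.
have phi1 : phi 1 = 1 by rewrite -[LHS]mulr1 -{2}[1]gK -phiM mul1r gK.
have D0 : D 0 = 0 by rewrite -[0 in LHS](mul0r 0) DM mulr0 phi0 mul0r addr0.
pose delta x y := D (x + y) - (D x + D y).
suff /eqP : delta a b = 0 by rewrite subr_eq0 => /eqP.
apply: (@defect_eq0 phi); rewrite /delta -?phiD ?peirce_idem_sum //.
- by move=> x; rewrite D0 !addr0 subrr.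
- by move=> x; rewrite D0 !add0r subrr.
(* Since [phi] is additive, the terms in [D z] cancel. *)
- move=> x y z; rewrite -mulrDl !DM phiD mulrBl !mulrDl.
  by rewrite (addrACA (D x * z)) [in RHS]opprD [RHS]addrACA subrr addr0.
- move=> x y z; rewrite -mulrDr !DM mulrBr !mulrDr.
  by rewrite (addrACA (D z * x)) [in RHS]opprD [RHS]addrACA subrr add0r.
Qed.

End Peirce.

Theorem theorem3p1 (R : pzRingType) (e : R)
    (he : nontrivial_idempotent e)
    (hR : peirce_right_faithful e)
    (phi D : R -> R)
    (hphi : multiplicative_automorphism phi)
    (hD : multiplicative_skew_derivation phi D) :
  additive_map D /\ skew_derivation phi D.
Proof.
have [ee _ _] := he; have [_ DM] := hD.
have phiA := conj (multiplicative_automorphism_additive ee hR hphi) hphi.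
have DD := multiplicative_skew_derivation_additive ee hR phiA DM.
by split.
Qed.
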